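(* For every positive integer $v\equiv 0\pmod{12}$, $\mathrm{URD}(v;P_2,P_3,P_4)=D(v)$. That is, for non-negative integers $r,s,t$, there exists a $(P_2,P_3,P_4)$-URD$(v;r,s,t)$ if and only if $(r,s,t)\in D(v)$.
   Context: $P_k$ denotes the path on $k$ vertices (so $P_2=K_2$ is a single edge), and $K_v$ the complete graph on $v$ vertices. A parallel class of a graph $G$ is a set of subgraphs (blocks) of $G$ such that every vertex of $G$ lies in exactly one block of the set. A $(P_2,P_3,P_4)$-URD$(v;r,s,t)$ is a partition of the edge set of $K_v$ into blocks (subgraphs isomorphic to $P_2$, $P_3$ or $P_4$), together with a partition of the set of blocks into parallel classes of $K_v$, such that exactly $r$ classes consist only of copies of $P_2$, exactly $s$ classes consist only of copies of $P_3$, exactly $t$ classes consist only of copies of $P_4$, and there are no other classes. $\mathrm{URD}(v;P_2,P_3,P_4)$ is the set of all triples $(r,s,t)$ of non-negative integers for which a $(P_2,P_3,P_4)$-URD$(v;r,s,t)$ exists. For $v\equiv 0\pmod{12}$ and an integer $0\le u\le \frac{v-1}{4}$, put $r(v,u)=\frac{v-3}{3}-\frac{4u}{3}$ if $u\equiv 0\pmod 3$; $r(v,u)=\frac{v-6}{3}-\frac{4(u-1)}{3}$ if $u\equiv 1\pmod 3$; $r(v,u)=\frac{v-9}{3}-\frac{4(u-2)}{3}$ if $u\equiv 2\pmod 3$. For $i=0,1,\dots,\frac{v-4}{4}$ let $D_i(v)=\{(v-1-4i-3y,\,3i,\,2y): y\in\mathbb{Z},\ 0\le y\le r(v,i)\}$,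 and let $D(v)=\bigcup_{i=0}^{(v-4)/4}D_i(v)$. *)

(* Defs.v *)
From mathcomp Require Import all_boot all_order all_algebra.

Set Implicit Arguments.
Unset Strict Implicit.
Unset Printing Implicit Defensive.

Import Order.TTheory GRing.Theory Num.Theory.

(* A graph whose vertices are taken in T is a pair (vertex set, edge set);
   [is_graph] says that the edges are 2-element sets of its vertices. *)
Definition graph (T : finType) : Type := ({set T} * {set {set T}})%type.

Definition vertices (T : finType) (G : graph T) : {set T} := G.1.
Definition edges (T : finType) (G : graph T) : {set {set T}} := G.2.

Definition is_graph (T : finType) (G : graph T) : bool :=
  [forall e in edges G, (e \subset vertices G) && (#|e| == 2)].

Definition subgraph (T : finType) (H G : graph T) : bool :=
  [&& is_graph H, vertices H \subset vertices G & edges H \subset edges G].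

Definition isomorphic (T U : finType) (G : graph T) (H : graph U) : bool :=
  [exists f : {ffun T -> U},
    [&& dinjectiveb f (mem (vertices G)),
        f @: vertices G == vertices H &
        [set f @: (e : {set T}) | e in edges G] == edges H]].

Definition complete_graph (v : nat) : graph 'I_v :=
  ([set: 'I_v], [set e : {set 'I_v} | #|e| == 2]).

(* The path on k vertices 0 - 1 - ... - k.-1. *)
Definition path_graph (k : nat) : graph 'I_k :=
  ([set: 'I_k],
   [set e : {set 'I_k} |
     [exists i : 'I_k, exists j : 'I_k,
       (val j == (val i).+1) && (e == [set i; j])]]).

Definition parallel_class (T : finType) (G : graph T)
    (C : {set graph T}) : Prop :=
  (forall B, B \in C -> subgraph B G) /\
  (forall x, x \in vertices G -> exists! B, B \in C /\ x \in vertices B).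

Definition edge_decomposition (T : finType) (G : graph T)
    (Bs : {set graph T}) : Prop :=
  (forall B, B \in Bs -> subgraph B G) /\
  (forall e, e \in edges G -> exists! B, B \in Bs /\ e \in edges B).

Definition path_class (T : finType) (k : nat) (C : {set graph T}) : bool :=
  [forall B in C, isomorphic (path_graph k) B].

(* Bs is the set of blocks and PC the set of parallel classes; [partition]
   excludes the empty class, so a class has at most one of the three types. *)
Definition is_URD (v r s t : nat) (Bs : {set graph 'I_v})
    (PC : {set {set graph 'I_v}}) : Prop :=
  [/\ edge_decomposition (complete_graph v) Bs,
      forall B, B \in Bs ->
        [|| isomorphic (path_graph 2) B, isomorphic (path_graph 3) B
          | isomorphic (path_graph 4) B],
      partition PC Bs,
      forall C, C \in PC -> parallel_class (complete_graph v) C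
    & [/\ #|[set C in PC | path_class 2 C]| = r,
          #|[set C in PC | path_class 3 C]| = s,
          #|[set C in PC | path_class 4 C]| = t
        & forall C, C \in PC ->
            [|| path_class 2 C, path_class 3 C | path_class 4 C]]].

Local Open Scope ring_scope.

(* URD(v; P_2, P_3, P_4), as a set of integer triples. *)
Definition URD (v : nat) (x : int * int * int) : Prop :=
  exists r s t : nat, x = (r%:Z, s%:Z, t%:Z) /\
    exists (Bs : {set graph 'I_v}) (PC : {set {set graph 'I_v}}),
      is_URD r s t Bs PC.

(* All the integer divisions below are exact when 3 %| v. *)
Definition ymax (v u : nat) : int :=
  match (u %% 3)%N with
  | 0%N => ((v%:Z - 3) %/ 3)%Z - ((4 * u%:Z) %/ 3)%Z
  | 1%N => ((v%:Z - 6) %/ 3)%Z - ((4 * (u%:Z - 1)) %/ 3)%Z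
  | _ => ((v%:Z - 9) %/ 3)%Z - ((4 * (u%:Z - 2)) %/ 3)%Z
  end.

Definition D_ (v i : nat) (x : int * int * int) : Prop :=
  exists y : int, 0 <= y <= ymax v i /\
    x = (v%:Z - 1 - 4 * i%:Z - 3 * y, 3 * i%:Z, 2 * y).

(* The division is exact and v - 4 is not truncated when 12 %| v and 0 < v. *)
Definition D (v : nat) (x : int * int * int) : Prop :=
  exists i : nat, (i <= (v - 4) %/ 4)%N /\ D_ v i x.

(* Main.v *)
Require Import Defs.
From mathcomp Require Import all_boot all_order all_algebra.
From mathcomp Require Import zify.
From Stdlib Require List.

Set Implicit Arguments.
Unset Strict Implicit.
Unset Printing Implicit Defensive.

(* Counting edges gives 6 r + 8 s + 9 t = 6 (v - 1), whose solutions in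
   nonnegative integers are exactly the triples of D(v).

   Conversely, two kinds of regular graphs on the vertices of K_v split into
   parallel classes of paths:
   - a cubic graph made of a perfect matching m preserving a 2-colouring c and a
     permutation f swapping the colours: the paths f x, x, m x, f (m x) with
     c x fixed form a class, so there are two P_4-classes; such a graph also
     splits into three 1-factors;
   - a quartic graph made of two permutations f and g that raise a 3-colouring
     c by 1 and by 2: the paths f x, x, g x with c x fixed form a class, so
     there are three P_3-classes.
   For v = 12 k put the vertices on {0, .., 2k - 1} x Z_6 and take the
   1-factorization GK of the complete graph on 2k vertices.  The first factor
   together with the copies of K_6 on its vertices gives copies of K_12, cut
   into b quartic graphs, 3 - b cubic graphs and 2 - b 1-factors for a chosen
   b < 3.  Each of the k - 1 pairs of consecutive further factors gives a
   12-regular graph, cut into three quartic or into four cubic graphs.  Both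
   cuttings depend only on the Z_6-coordinates and on the side of a
   2-colouring of the factors, which leaves a finite verification. *)

(** * Edge counts of parallel classes and the weight equation *)

(** Double counting of the pairs (B, x) with x in [F B]; applied to the vertices of a class and to
    the edges of a decomposition. *)
Lemma sum_card_cover (I X : finType) (C : {set I}) (F : I -> {set X})
    (A : {set X}) :
  (forall B, B \in C -> F B \subset A) ->
  (forall x, x \in A -> exists! B, B \in C /\ x \in F B) ->
  \sum_(B in C) #|F B| = #|A|.
Proof.
move=> sFA uniqF.
transitivity (\sum_(B in C) \sum_(x in A) (x \in F B : nat)).
  apply: eq_bigr => B CB; rewrite -sum1_card [RHS]big_mkcond /=.
  rewrite big_mkcond; apply: eq_bigr => x _ /=.
  by case: ifP => [/(subsetP (sFA B CB)) ->|_] //; case: ifP.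
rewrite exchange_big /= -sum1_card; apply: eq_bigr => x Ax.
have [B [[CB FBx] uB]] := uniqF x Ax.
rewrite (bigD1 B) //= FBx big1 ?addn0 // => B' /andP[CB' neqB].
apply/eqP; rewrite eqb0; apply: contra neqB => FB'x.
by rewrite eq_sym; apply/eqP/uB.
Qed.

Lemma card_path_graph_edges k : #|edges (path_graph k.+1)| = k.
Proof.
pose F (i : 'I_k) := [set (widen_ord (leqnSn k) i); lift ord0 i].
have -> : edges (path_graph k.+1) = [set F i | i : 'I_k].
  apply/setP=> e; rewrite inE; apply/existsP/imsetP => /=.
    move=> [i /existsP[j /andP[/eqP ji /eqP->]]].
    have lt_ik : i < k by rewrite -ltnS -ji.
    exists (Ordinal lt_ik) => //; congr [set _; _]; apply: val_inj => //=.
  move=> [i _ ->]; exists (widen_ord (leqnSn k) i).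
  by apply/existsP; exists (lift ord0 i); rewrite /= eqxx /bump eqxx.
rewrite card_imset ?card_ord // => i j eqF; apply: val_inj => /=.
have: widen_ord (leqnSn k) i \in F j by rewrite -eqF set21.
have: widen_ord (leqnSn k) j \in F i by rewrite eqF set21.
rewrite !in_set2 -!(inj_eq val_inj) /= /bump /=.
lia.
Qed.

Lemma isomorphic_path_card (T : finType) k (B : graph T) :
  isomorphic (path_graph k.+1) B ->
  #|vertices B| = k.+1 /\ #|edges B| = k.
Proof.
case/existsP=> f /and3P[/dinjectiveP injf /eqP <- /eqP <-].
have f_inj : injective f by move=> x y; apply: injf; rewrite inE.
rewrite card_imset // cardsT card_ord; split=> //.
by rewrite card_imset ?card_path_graph_edges //; apply: imset_inj.
Qed.

Definition is_path_class v (C : {set graph 'I_v}) : bool :=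
  [|| path_class 2 C, path_class 3 C | path_class 4 C].

Lemma parallel_class_neq0 v (C : {set graph 'I_v.+1}) :
  parallel_class (complete_graph v.+1) C -> C != set0.
Proof.
by case=> _ /(_ ord0 (in_setT _)) [B [[CB _] _]]; apply/set0Pn; exists B.
Qed.

Lemma path_class_inj (T : finType) (C : {set graph T}) k l :
  C != set0 -> path_class k.+1 C -> path_class l.+1 C -> k = l.
Proof.
case/set0Pn=> B CB /forall_inP/(_ B CB)/isomorphic_path_card[_ <-].
by move=> /forall_inP/(_ B CB)/isomorphic_path_card[].
Qed.

Lemma path_class_edges v k (C : {set graph 'I_v}) :
  path_class k.+1 C -> parallel_class (complete_graph v) C ->
  k.+1 * \sum_(B in C) #|edges B| = k * v.
Proof.
move=> /forall_inP isoC [subC uniqC].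
transitivity (k * \sum_(B in C) #|vertices B|).
  rewrite !big_distrr; apply: eq_bigr => B /isoC/isomorphic_path_card[/= -> ->].
  by rewrite mulnC.
by rewrite (@sum_card_cover _ _ _ _ [set: 'I_v]) ?cardsT ?card_ord.
Qed.

(** On n vertices a class of P_2, P_3 or P_4 has n/2, 2n/3 or 3n/4 edges; the factor 12 clears
    denominators. A nonempty class has only one type, so one indicator survives. *)
Lemma path_class_weight v (C : {set graph 'I_v.+1}) :
  is_path_class C -> parallel_class (complete_graph v.+1) C ->
  12 * \sum_(B in C) #|edges B| =
    (6 * path_class 2 C + 8 * path_class 3 C + 9 * path_class 4 C) * v.+1.
Proof.
move=> pC parC; have nC := parallel_class_neq0 parC.
have inj := (fun k l => path_class_inj (k := k) (l := l) nC).
have E k (pk : path_class k.+1 C) := path_class_edges pk parC.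
move: pC; rewrite /is_path_class.
case E2: (path_class 2 C); case E3: (path_class 3 C); case E4: (path_class 4 C);
  rewrite //= => _.
- by have := inj _ _ E2 E3.
- by have := inj _ _ E2 E3.
- by have := inj _ _ E2 E4.
- by have := E _ E2; set S := bigop _ _ _; lia.
- by have := inj _ _ E3 E4.
- by have := E _ E3; set S := bigop _ _ _; lia.
- by have := E _ E4; set S := bigop _ _ _; lia.
Qed.

Lemma card_complete_graph_edges v :
  2 * #|edges (complete_graph v.+1)| = v.+1 * v.
Proof.
rewrite card_draws card_ord; have := mul_bin_diag v.+1 1; rewrite bin1 => <-.
by [].
Qed.

Lemma sum_nat_bool (I : finType) (A : {set I}) (P : pred I) :
  \sum_(x in A) (P x : nat) = #|[set x in A | P x]|.
Proof.
rewrite -sum1_card big_mkcond [RHS]big_mkcond; apply: eq_bigr => x _.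
by rewrite inE; case: (x \in A); case: (P x).
Qed.

Lemma sum_weight (I : finType) (A : {set I}) (P Q R : pred I) :
  \sum_(x in A) (6 * P x + 8 * Q x + 9 * R x) =
    6 * #|[set x in A | P x]| + 8 * #|[set x in A | Q x]|
      + 9 * #|[set x in A | R x]|.
Proof. by rewrite -!sum_nat_bool !big_distrr -!big_split. Qed.

Lemma URD_weight v r s t Bs PC :
  @is_URD v.+1 r s t Bs PC -> 6 * r + 8 * s + 9 * t = 6 * v.
Proof.
case=> [[subB uniqB] _ /and3P[/eqP covPC trivPC nPC] parPC [<- <- <- pPC]].
have : \sum_(B in Bs) #|edges B| = #|edges (complete_graph v.+1)|.
  by apply: sum_card_cover => // B /subB /and3P[].
rewrite -covPC big_trivIset //= => E.
have : 12 * #|edges (complete_graph v.+1)| =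
    \sum_(C in PC)
      (6 * path_class 2 C + 8 * path_class 3 C + 9 * path_class 4 C) * v.+1.
  rewrite -E big_distrr; apply: eq_bigr => C PCC.
  by apply: path_class_weight (pPC C PCC) (parPC C PCC).
rewrite -big_distrl /= sum_weight.
have := card_complete_graph_edges v; set N := #|_| => EN EW.
have {}EN : 12 * N = 6 * v * v.+1 by lia.
by move/eqP: EW; rewrite EN eqn_pmul2r // => /eqP.
Qed.

(** * From a list of parallel classes to a URD *)

(* By counting, a family of classes of the right total size that covers every
   edge covers it only once. *)
Lemma classes_cover_once v (PCs : seq {set graph 'I_v.+1}) :
  (forall C, C \in PCs ->
     is_path_class C /\ parallel_class (complete_graph v.+1) C) ->
  (forall e, e \in edges (complete_graph v.+1) ->
     exists2 C, C \in PCs & exists2 B, B \in C & e \in edges B) ->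
  6 * count (@path_class _ 2) PCs + 8 * count (@path_class _ 3) PCs
    + 9 * count (@path_class _ 4) PCs = 6 * v ->
  forall e, e \in edges (complete_graph v.+1) ->
  \sum_(i < size PCs) #|[set B in nth set0 PCs i | e \in edges B]| = 1.
Proof.
move=> okC covE countC e0 Ee0.
set E := edges _ in covE Ee0.
pose N e := \sum_(C <- PCs) #|[set B in C | e \in edges B]|.
have -> : \sum_(i < size PCs) #|[set B in nth set0 PCs i | e0 \in edges B]| = N e0.
  by rewrite /N (big_nth set0) big_mkord.
have sumN : \sum_(e in E) N e = #|E|.
  rewrite /N exchange_big /=.
  have -> : \sum_(C <- PCs) \sum_(e in E) #|[set B in C | e \in edges B]|
          = \sum_(C <- PCs) \sum_(B in C) #|edges B|.
    rewrite big_seq [RHS]big_seq; apply: eq_bigr => C /okC[_ [subC _]].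
    transitivity (\sum_(e in E) \sum_(B in C) (e \in edges B : nat)).
      by apply: eq_bigr => e _; rewrite sum_nat_bool.
    rewrite exchange_big /=; apply: eq_bigr => B /subC/and3P[_ _ sBE].
    rewrite sum_nat_bool; congr #|pred_of_set _|; apply/setP=> e.
    by rewrite inE andb_idl // => /(subsetP sBE).
  have : 12 * \sum_(C <- PCs) \sum_(B in C) #|edges B| = 6 * v * v.+1.
    rewrite -countC -!sum1_count !big_distrr !(big_mkcond (path_class _)) /=.
    rewrite -!big_split big_distrl /=.
    rewrite big_seq [RHS]big_seq; apply: eq_bigr => C /okC[pC parC].
    rewrite path_class_weight //.
    by case: path_class; case: path_class; case: path_class.
  have := card_complete_graph_edges v; rewrite -/E.
  by set m := #|_|; set S := (X in 12 * X); lia.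
have N_gt0 e : e \in E -> 0 < N e.
  move=> /covE[C PC_C [B CB eB]]; rewrite /N (big_rem C) //= addn_gt0.
  by apply/orP; left; apply/card_gt0P; exists B; rewrite inE CB.
(* The multiplicities [N e] are positive and sum to the number of edges, so no edge exceeds 1. *)
have : \sum_(e in E) (N e).-1 = 0.
  apply: (@addIn #|E|); rewrite add0n -[RHS]sumN -sum1_card -big_split.
  by apply: eq_bigr => e /N_gt0; case: (N e) => // n _; rewrite /= addn1.
move/eqP; rewrite sum_nat_eq0 => /forall_inP/(_ e0 Ee0)/eqP.
by have := N_gt0 e0 Ee0; case: (N e0) => // n _ /= ->.
Qed.

Lemma URD_of_classes v (PCs : seq {set graph 'I_v.+1}) :
  (forall C, C \in PCs ->
     is_path_class C /\ parallel_class (complete_graph v.+1) C) ->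
  (forall e, e \in edges (complete_graph v.+1) ->
     exists2 C, C \in PCs & exists2 B, B \in C & e \in edges B) ->
  6 * count (@path_class _ 2) PCs + 8 * count (@path_class _ 3) PCs
    + 9 * count (@path_class _ 4) PCs = 6 * v ->
  @is_URD v.+1 (count (@path_class _ 2) PCs) (count (@path_class _ 3) PCs)
    (count (@path_class _ 4) PCs) (cover [set C in PCs]) [set C in PCs].
Proof.
move=> okC covE countC.
have N1 := @classes_cover_once v PCs okC covE countC.
set E := edges _ in covE N1.
(* An edge determines its block and the position of its class in the list. Hence the list has no
   repetition and the classes are disjoint. *)
have uniqE i j B B' e : i < size PCs -> j < size PCs ->
    B \in nth set0 PCs i -> B' \in nth set0 PCs j ->
    e \in E -> e \in edges B -> e \in edges B' -> i = j /\ B = B'.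
  move=> lti ltj Bi Bj Ee eB eB'.
  have := N1 e Ee; rewrite (bigD1 (Ordinal lti)) //=.
  have ci : 0 < #|[set B in nth set0 PCs i | e \in edges B]|.
    by apply/card_gt0P; exists B; rewrite inE Bi.
  have cj : 0 < #|[set B in nth set0 PCs j | e \in edges B]|.
    by apply/card_gt0P; exists B'; rewrite inE Bj.
  have [eq_ij|neq_ij] := eqVneq i j.
    move=> /eqP N_eq1; split=> //.
    have : #|[set B in nth set0 PCs i | e \in edges B]| <= 1.
      by rewrite -(eqP N_eq1) leq_addr.
    by move/card_le1_eqP; apply; rewrite inE ?Bi ?eq_ij ?Bj.
  rewrite (bigD1 (Ordinal ltj)) /= ?addnA => [eqN|].
    by have := leq_trans (leq_add ci cj) (leq_trans (leq_addr _ _) (eq_leq eqN)).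
  by rewrite -val_eqE /= eq_sym.
have okn i : i < size PCs ->
    is_path_class (nth set0 PCs i) /\
    parallel_class (complete_graph v.+1) (nth set0 PCs i).
  by move=> lti; apply: okC; apply: mem_nth.
have blockE C B : C \in PCs -> B \in C ->
    subgraph B (complete_graph v.+1) /\ exists2 e, e \in E & e \in edges B.
  move=> PC_C CB; have [pC [/(_ B CB) subB _]] := okC C PC_C; split=> //.
  suff /card_gt0P[e eB] : 0 < #|edges B|.
    by exists e => //; have /and3P[_ _ /subsetP->] := subB.
  by case/or3P: pC => /forall_inP/(_ B CB)/isomorphic_path_card[_ ->].
have nE i : i < size PCs -> exists2 B, B \in nth set0 PCs i &
    exists2 e, e \in E & e \in edges B.
  move=> lti; have [_ /parallel_class_neq0/set0Pn[B Bi]] := okn i lti.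
  by exists B => //; apply: (blockE _ _ _ Bi).2; apply: mem_nth.
have uniqPC : uniq PCs.
  apply/(uniqP set0) => i j lti ltj eq_ij.
  have [B Bi [e Ee eB]] := nE i lti.
  by have [] := uniqE i j B B e lti ltj Bi _ Ee eB eB; rewrite -?eq_ij.
have cardPC (P : pred {set graph 'I_v.+1}) :
    #|[set C in [set C in PCs] | P C]| = count P PCs.
  rewrite -size_filter -(card_uniqP (filter_uniq P uniqPC)).
  by apply: eq_card => C; rewrite !inE mem_filter andbC.
split.
- split=> [B|e Ee].
    by case/bigcupP=> C; rewrite inE => /blockE H /H[].
  have [C PC_C [B CB eB]] := covE e Ee.
  exists B; split=> [|B' [/bigcupP[C']]].
    by split=> //; apply/bigcupP; exists C; rewrite ?inE.
  rewrite inE => PC_C' CB' eB'.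
  have [] // := uniqE (index C PCs) (index C' PCs) B B' e;
    by rewrite ?index_mem ?nth_index.
- move=> B /bigcupP[C]; rewrite inE => /okC[pC _] CB.
  by case/or3P: pC => /forall_inP/(_ B CB) ->; rewrite ?orbT.
- apply/and3P; split=> //.
    apply/trivIsetP=> C C'; rewrite !inE => PC_C PC_C'; apply: contraR.
    rewrite -setI_eq0 => /set0Pn[B /setIP[CB CB']].
    have [_ [e Ee eB]] := blockE C B PC_C CB.
    have [] := uniqE (index C PCs) (index C' PCs) B B e;
      rewrite ?index_mem ?nth_index //.
    by move=> /(congr1 (nth set0 PCs)); rewrite !nth_index // => ->.
  rewrite inE; apply/negP=> /okC[_ /parallel_class_neq0].
  by rewrite eqxx.
- by move=> C; rewrite inE => /okC[].
- by split; rewrite ?cardPC // => C; rewrite inE => /okC[].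
Qed.

(** * Paths as sequences, and classes made of them *)

Definition path_of (T : finType) (s : seq T) : graph T :=
  ([set x in s], [set e in [seq [set p.1; p.2] | p <- zip s (behead s)]]).

Lemma path_of_iso (T : finType) (s : seq T) :
  uniq s -> isomorphic (path_graph (size s)) (path_of s).
Proof.
move=> uniq_s; apply/existsP; exists [ffun i => tnth (in_tuple s) i].
have f2 (i j : 'I_(size s)) :
    [ffun i => tnth (in_tuple s) i] @: [set i; j]
      = [set tnth (in_tuple s) i; tnth (in_tuple s) j].
  by rewrite imsetU !imset_set1 !ffunE.
apply/and3P; split.
- apply/dinjectiveP=> i j _ _; rewrite !ffunE.
  exact: (tuple_uniqP (in_tuple s)).
- apply/eqP/setP=> x; rewrite inE; apply/imsetP/(tnthP (in_tuple s)) => [[i _ ->]|[i ->]].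
    by exists i; rewrite ffunE.
  by exists i; rewrite ?ffunE ?inE.
- apply/eqP/setP=> e; rewrite inE; apply/imsetP/mapP.
    move=> [_ /[!inE] /existsP[i /existsP[j /andP[/eqP ji /eqP->]]] ->].
    pose x0 := tnth (in_tuple s) i.
    have lti : i < size (zip s (behead s)).
      have : i.+1 < size s by rewrite -[i.+1]ji ltn_ord.
      by rewrite size_zip size_behead; lia.
    exists (nth (x0, x0) (zip s (behead s)) i); first exact: mem_nth.
    by rewrite f2 nth_zip_cond lti nth_behead -ji /= !(tnth_nth x0).
  move=> [p p_s ->]; set i := index p (zip s (behead s)).
  have lti : i < size (zip s (behead s)) by rewrite index_mem.
  have ltis : i < size s by move: lti; rewrite size_zip; lia.
  have ltSis : i.+1 < size s by move: lti; rewrite size_zip size_behead; lia.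
  exists [set Ordinal ltis; Ordinal ltSis].
    by rewrite inE; apply/existsP; exists (Ordinal ltis); apply/existsP;
      exists (Ordinal ltSis); rewrite !eqxx.
  have Ep : p = (nth p.1 s i, nth p.2 s i.+1).
    have E q : nth q (zip s (behead s)) i = (nth q.1 s i, nth q.2 s i.+1).
      by case: q => x y; rewrite nth_zip_cond lti nth_behead.
    by rewrite -E nth_index.
  rewrite f2; congr [set _; _].
    by rewrite (tnth_nth p.1) [LHS](congr1 fst Ep).
  by rewrite (tnth_nth p.2) [LHS](congr1 snd Ep).
Qed.

Lemma path_of_subgraph v (s : seq 'I_v) :
  uniq s -> subgraph (path_of s) (complete_graph v).
Proof.
move=> uniq_s.
have E2 e : e \in edges (path_of s) ->
    (e \subset vertices (path_of s)) && (#|e| == 2).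
  rewrite inE => /mapP[[x y] /= s_xy ->].
  case: s uniq_s s_xy => // z s /=; elim: s z => // t s IH z /=.
  rewrite inE negb_or => /andP[/andP[nz _] ust] /predU1P[[-> ->]|/(IH t ust)].
    rewrite subUset !sub1set !inE !eqxx orbT cards2.
    by rewrite nz.
  case/andP=> /subsetP sub ->; rewrite andbT; apply/subsetP=> u /sub.
  by rewrite !inE => ->; rewrite orbT.
apply/and3P; split.
- by apply/forall_inP.
- exact: subsetT.
- by apply/subsetP=> e /E2/andP[_]; rewrite inE.
Qed.

(** Overlapping sequences need only give equal graphs: a path may be listed once from each of its
    two orientations. *)
Lemma paths_class v k (S : {set 'I_v}) (s : 'I_v -> seq 'I_v) :
  (forall x, x \in S -> uniq (s x) /\ size (s x) = k) ->
  (forall y, exists2 x, x \in S & y \in s x) ->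
  (forall x x' y, x \in S -> x' \in S -> y \in s x -> y \in s x' ->
     path_of (s x) = path_of (s x')) ->
  path_class k [set path_of (s x) | x in S] /\
  parallel_class (complete_graph v) [set path_of (s x) | x in S].
Proof.
move=> s_path s_cov s_uniq; split; last split.
- apply/forall_inP=> _ /imsetP[x Sx ->]; have [us <-] := s_path x Sx.
  exact: path_of_iso.
- move=> _ /imsetP[x Sx ->]; apply: path_of_subgraph.
  by case: (s_path x Sx).
- move=> y _; have [x Sx sxy] := s_cov y.
  exists (path_of (s x)); split; first by split; [apply: imset_f | rewrite inE].
  move=> _ [/imsetP[x' Sx' ->]]; rewrite inE => sx'y.
  exact: s_uniq y Sx Sx' sxy sx'y.
Qed.

(** * Regular graphs that split into classes of paths *)

(* f' and g' stand for the inverses of f and g. *)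
Inductive piece (V : Type) : Type :=
| Factor of V -> V
| Cubic of (V -> bool) & V -> V & V -> V & V -> V
| Quartic of (V -> nat) & V -> V & V -> V & V -> V & V -> V.

Definition neighbours V (U : piece V) (x : V) : seq V :=
  match U with
  | Factor m => [:: m x]
  | Cubic _ m f f' => [:: m x; f x; f' x]
  | Quartic _ f f' g g' => [:: f x; f' x; g x; g' x]
  end.

Definition is_factor V (U : piece V) := if U is Factor _ then true else false.
Definition is_cubic V (U : piece V) :=
  if U is Cubic _ _ _ _ then true else false.
Definition is_quartic V (U : piece V) :=
  if U is Quartic _ _ _ _ _ then true else false.

Definition wf_piece (V : Type) (U : piece V) : Prop :=
  match U with
  | Factor m => involutive m /\ (forall x, m x <> x)
  | Cubic c m f f' =>
    [/\ involutive m, forall x, m x <> x, cancel f f', cancel f' f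
      & forall x, c (m x) = c x /\ c (f x) = ~~ c x]
  | Quartic c f f' g g' =>
    [/\ cancel f f', cancel f' f, cancel g g', cancel g' g
      & forall x, [/\ c x < 3, c (f x) = (c x + 1) %% 3 & c (g x) = (c x + 2) %% 3]]
  end.

Definition classes v (U : piece 'I_v) : seq {set graph 'I_v} :=
  match U with
  | Factor m => [:: [set path_of [:: x; m x] | x in [set: 'I_v]]]
  | Cubic c m f f' =>
    [seq [set path_of [:: f x; x; m x; f (m x)] | x in [set x | c x == b]]
       | b <- [:: true; false]]
  | Quartic c f f' g g' =>
    [seq [set path_of [:: f x; x; g x] | x in [set x | c x == j]]
       | j <- iota 0 3]
  end.

Definition path_size V (U : piece V) :=
  match U with Factor _ => 2 | Cubic _ _ _ _ => 4 | Quartic _ _ _ _ _ => 3 end.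

Lemma classes_ok v (U : piece 'I_v) C :
  wf_piece U -> C \in classes U ->
  path_class (path_size U) C /\ parallel_class (complete_graph v) C.
Proof.
rewrite /classes; case: U => [m|c m f f'|c f f' g g'].
- move=> [mK nm]; rewrite inE => /eqP->; apply: paths_class.
  + by move=> x _; split=> //=; rewrite inE andbT eq_sym; apply/eqP.
  + by move=> y; exists y; rewrite ?inE ?eqxx.
  + move=> x x' y _ _.
    have flip z : path_of [:: z; m z] = path_of [:: m z; m (m z)].
      rewrite mK /path_of /=; congr pair; apply/setP=> t; rewrite !inE.
        by rewrite orbC.
      by rewrite setUC.
    rewrite !inE => /orP[]/eqP-> /orP[]/eqP.
    * by move->.
    * by move->; rewrite -flip.
    * by move<-.
    * by move/(can_inj mK)->.
- move=> [mK nm fK f'K cE].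
  have cm x := (cE x).1; have cf x := (cE x).2.
  case/mapP=> b _ ->; apply: paths_class.
  + move=> x _; split=> //=.
    have nf y z : c y = c z -> f y != z.
      by move=> cyz; apply: contra_eqN cyz => /eqP<-; rewrite cf; case: (c y).
    have nm' : x != m x by apply/eqP=> /esym/nm.
    rewrite !inE !negb_or (inj_eq (can_inj fK)) nm' !nf ?cm //.
    by rewrite ![_ == f _]eq_sym !nf ?cm.
  + move=> y; case: (eqVneq (c y) b) => [cy|ncy].
      by exists y; rewrite ?inE ?cy ?eqxx ?orbT.
    exists (f' y); rewrite !inE ?f'K ?eqxx //.
    have := cf (f' y); rewrite f'K => Ey.
    by move: ncy; rewrite Ey; case: (c _); case: b.
  + move=> x x' y; rewrite !inE => /eqP cx /eqP cx'.
    have flip z : path_of [:: f z; z; m z; f (m z)]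
                = path_of [:: f (m z); m z; m (m z); f (m (m z))].
      rewrite mK /path_of /=; congr pair; apply/setP=> t; rewrite !inE.
        by do 4!case: (t == _).
      rewrite (setUC [set f (m z)] [set m z]) (setUC [set m z] [set z]).
      rewrite (setUC [set z] [set f z]).
      by do 3!case: (t == _).
    (* In the path of u the vertices of colour b are u and [m u], the others are their images under
       f; injectivity of f then locates w. *)
    have core u w : c u = b -> c w = b -> y \in [:: f u; u; m u; f (m u)] ->
      y = w \/ y = f w -> w = u \/ w = m u.
      move=> cu cw; rewrite !inE => yu yw.
      have cyu : (c y == b) -> (y == u) || (y == m u).
        move=> cy; case/or4P: yu cy => /eqP->; rewrite ?eqxx ?orbT //.
          by rewrite cf cu; case: (b).
        by rewrite cf cm cu; case: (b).
      have cyu' : (c y != b) -> (y == f u) || (y == f (m u)).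
        move=> cy; case/or4P: yu cy => /eqP->; rewrite ?eqxx ?orbT //.
          by rewrite cu eqxx.
        by rewrite cm cu eqxx.
      case: yw => yw.
        by move: cyu; rewrite yw cw eqxx => /(_ isT)/orP[]/eqP; [left|right].
      move: cyu'; rewrite yw cf cw; case: (b) => /(_ isT)/orP[]/eqP/(can_inj fK);
        by [left|right].
    move=> yx yx'.
    (* Of x' and [m x'], which give the same path reversed, w is the one on the same half of the
       path as y. *)
    have [w cw [Ew Hw]] : exists2 w, c w = b &
        path_of [:: f w; w; m w; f (m w)] = path_of [:: f x'; x'; m x'; f (m x')]
        /\ (y = w \/ y = f w).
      have cmx' : c (m x') = b by rewrite cm.
      case/or4P: yx' => /eqP->; [exists x'|exists x'|exists (m x')|exists (m x')];
      by rewrite -?flip; auto.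
    have yin : y \in [:: f x; x; m x; f (m x)] by rewrite !inE.
    by rewrite -Ew; have [->|->] := core x w cx cw yin Hw.
- move=> [fK f'K gK g'K cE].
  have c3 x : c x < 3 by case: (cE x).
  have cf x : c (f x) = (c x + 1) %% 3 by case: (cE x).
  have cg x : c (g x) = (c x + 2) %% 3 by case: (cE x).
  case/mapP=> j; rewrite mem_iota => ltj3 ->; apply: paths_class.
  + move=> x; rewrite inE => /eqP cx; split=> //=.
    have ne y z : c y != c z -> y != z by apply: contra_neq => ->.
    rewrite !inE !negb_or !andbT !ne ?cf ?cg //; have := c3 x; lia.
  + move=> y; have := c3 y.
    have := cf (f' y); rewrite f'K; have := c3 (f' y).
    have := cg (g' y); rewrite g'K; have := c3 (g' y) => lt1 E1 lt2 E2 lt3.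
    (* Modulo 3, [f' y] has colour c y - 1 and [g' y] has colour c y - 2; whichever of the three has
       colour j is the centre of a path through y. *)
    have [cy|[cy|cy]] : c y = j \/ c (f' y) = j \/ c (g' y) = j by lia.
    * by exists y; rewrite !inE ?cy ?eqxx ?orbT.
    * by exists (f' y); rewrite !inE ?cy ?f'K ?eqxx ?orbT.
    * by exists (g' y); rewrite !inE ?cy ?g'K ?eqxx ?orbT.
  + move=> x x' y; rewrite !inE => /eqP cx /eqP cx' yx yx'.
    suff -> : x = x' by [].
    (* The three vertices of a path have distinct colours, so y holds the same position in both
       paths. *)
    case/or3P: yx => /eqP Ey; case/or3P: yx' => /eqP Ey';
      have := congr1 c Ey; have := congr1 c Ey';
      rewrite ?cf ?cg ?cx ?cx' => E1 E2; try lia.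
    * by apply: (can_inj fK); rewrite -Ey.
    * by rewrite -Ey.
    * by apply: (can_inj gK); rewrite -Ey.
Qed.

(** An edge from y to [f' y] or [g' y] is found in the path based at that neighbour, the other edges
    in a path based at y. *)
Lemma classes_cover v (U : piece 'I_v) y z :
  wf_piece U -> z \in neighbours U y ->
  exists2 C, C \in classes U & exists2 B, B \in C & [set y; z] \in edges B.
Proof.
case: U => [m|c m f f'|c f f' g g'].
- move=> _; rewrite inE => /eqP->.
  eexists; first exact: mem_head.
  by exists (path_of [:: y; m y]); [apply: imset_f | rewrite !inE].
- move=> [mK nm fK f'K cE].
  have block x e : e \in edges (path_of [:: f x; x; m x; f (m x)]) ->
      exists2 C, C \in classes (Cubic c m f f') & exists2 B, B \in C & e \in edges B.
    move=> eB; exists [set path_of [:: f t; t; m t; f (m t)] | t in [set t | c t == c x]].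
      by rewrite !inE; case: (c x); rewrite eqxx ?orbT.
    by exists (path_of [:: f x; x; m x; f (m x)]) => //; apply: imset_f; rewrite inE.
  rewrite !inE => /or3P[]/eqP->.
  + by apply: (block y); rewrite !inE eqxx ?orbT.
  + by apply: (block y); rewrite !inE setUC eqxx ?orbT.
  + by apply: (block (f' y)); rewrite !inE f'K eqxx ?orbT.
- move=> [fK f'K gK g'K cE].
  have block x e : e \in edges (path_of [:: f x; x; g x]) ->
      exists2 C, C \in classes (Quartic c f f' g g') & exists2 B, B \in C & e \in edges B.
    move=> eB; exists [set path_of [:: f t; t; g t] | t in [set t | c t == c x]].
      apply/mapP; exists (c x) => //; rewrite mem_iota.
      by have [] := cE x.
    by exists (path_of [:: f x; x; g x]) => //; apply: imset_f; rewrite inE.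
  rewrite !inE => /or4P[]/eqP->.
  + by apply: (block y); rewrite !inE setUC eqxx ?orbT.
  + by apply: (block (f' y)); rewrite !inE f'K eqxx ?orbT.
  + by apply: (block y); rewrite !inE eqxx ?orbT.
  + by apply: (block (g' y)); rewrite !inE g'K setUC eqxx ?orbT.
Qed.

Lemma count_classes v (U : piece 'I_v.+1) k :
  wf_piece U ->
  count (@path_class _ k.+1) (classes U) = (k.+1 == path_size U) * size (classes U).
Proof.
move=> wfU; have sizeU : path_size U = (path_size U).-1.+1 by case: (U).
transitivity (count (fun=> k.+1 == path_size U) (classes U)).
  apply: eq_in_count => C UC; have [pC parC] := classes_ok wfU UC.
  have nC := parallel_class_neq0 parC.
  apply/idP/eqP => [pkC|->] //.
  by rewrite sizeU in pC *; rewrite (path_class_inj nC pkC pC).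
by case: eqP => _; rewrite ?count_predT ?count_pred0 ?mul1n.
Qed.

(** The pieces have degrees 1, 3 and 4 and yield one P_2-class, two P_4-classes and three
    P_3-classes, of weights 6, 18 and 24, that is 6 times the degree. Degrees adding up to v give
    the total that makes a covering exact. *)
Lemma URD_of_pieces v (Us : seq (piece 'I_v.+1)) :
  List.Forall (@wf_piece _) Us ->
  (forall x y, x != y -> has (fun U => y \in neighbours U x) Us) ->
  count (@is_factor _) Us + 3 * count (@is_cubic _) Us
    + 4 * count (@is_quartic _) Us = v ->
  exists Bs PC, @is_URD v.+1 (count (@is_factor _) Us)
     (3 * count (@is_quartic _) Us) (2 * count (@is_cubic _) Us) Bs PC.
Proof.
move=> wfUs covUs countUs.
pose PCs := flatten [seq classes U | U <- Us].
have okPCs C : C \in PCs ->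
    is_path_class C /\ parallel_class (complete_graph v.+1) C.
  rewrite /PCs; elim: wfUs => //= U {covUs countUs PCs}Us wfU _ IH.
  rewrite mem_cat => /orP[UC|/IH] //; have [pC parC] := classes_ok wfU UC.
  by split=> //; move: pC; rewrite /is_path_class; case: (U) => * /=; apply/or3P;
    [constructor 1 | constructor 3 | constructor 2].
have covPCs e : e \in edges (complete_graph v.+1) ->
    exists2 C, C \in PCs & exists2 B, B \in C & e \in edges B.
  rewrite inE => /cards2P[x [y [nxy ->]]]; have := covUs x y nxy.
  rewrite /PCs; elim: wfUs => //= U {covUs countUs PCs okPCs}Us wfU _ IH.
  case/orP=> [/(classes_cover wfU)[C UC B]|/IH[C UsC B]];
    by exists C; rewrite ?mem_cat ?UC ?UsC ?orbT.
have [E2 E3 E4] : [/\ count (@path_class _ 2) PCs = count (@is_factor _) Us,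
    count (@path_class _ 3) PCs = 3 * count (@is_quartic _) Us
  & count (@path_class _ 4) PCs = 2 * count (@is_cubic _) Us].
  rewrite /PCs; elim: wfUs => //= U {covUs countUs PCs okPCs covPCs}Us wfU _ [E2 E3 E4].
  rewrite !count_cat !count_classes // E2 E3 E4 !mulnDr.
  by split; congr (_ + _); case: (U).
rewrite -E2 -E3 -E4; exists (cover [set C in PCs]), [set C in PCs].
by apply: URD_of_classes => //; rewrite E2 E3 E4; lia.
Qed.

(** Keeps y cubic pieces for P_4-classes and splits each of the others into three 1-factors. *)
Lemma URD_of_pieces_split v (Us : seq (piece 'I_v.+1)) y :
  List.Forall (@wf_piece _) Us ->
  (forall x y, x != y -> has (fun U => y \in neighbours U x) Us) ->
  count (@is_factor _) Us + 3 * count (@is_cubic _) Us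
    + 4 * count (@is_quartic _) Us = v ->
  y <= count (@is_cubic _) Us ->
  exists Bs PC, @is_URD v.+1
     (count (@is_factor _) Us + 3 * (count (@is_cubic _) Us - y))
     (3 * count (@is_quartic _) Us) (2 * y) Bs PC.
Proof.
move=> wfUs covUs countUs ley.
have [Us' [wfUs' covUs' Ef Ec Eq]] : exists Us' : seq (piece 'I_v.+1),
    [/\ List.Forall (@wf_piece _) Us',
        forall x z, has (fun U => z \in neighbours U x) Us ->
          has (fun U => z \in neighbours U x) Us',
        count (@is_factor _) Us' =
          count (@is_factor _) Us + 3 * (count (@is_cubic _) Us - y),
        count (@is_cubic _) Us' = y
      & count (@is_quartic _) Us' = count (@is_quartic _) Us].
  elim: wfUs y ley => [|U {covUs countUs}Us wfU _ IH] y ley.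
    by exists [::]; move: ley => /= /[!leqn0]/eqP->; split.
  case: U wfU ley => [m|c m f f'|c f f' g g'] wfU /= ley.
  - have [Us' [wfUs' cov' Ef Ec Eq]] := IH y ley.
    exists (Factor m :: Us'); split=> /=; [by constructor | | lia..].
    by move=> x z /orP[->|/cov' ->]; rewrite ?orbT.
  - have [eq_y|ne_y] := eqVneq y (count (@is_cubic _) Us).+1.
      have [Us' [wfUs' cov' Ef Ec Eq]] := IH y.-1 ltac:(lia).
      exists (Cubic c m f f' :: Us'); split=> /=; [by constructor | | lia..].
      by move=> x z /orP[->|/cov' ->]; rewrite ?orbT.
    have [Us' [wfUs' cov' Ef Ec Eq]] := IH y ltac:(lia).
    (* The arcs from x to [f x] with x of colour b form a perfect matching, since f swaps the
       colours; [h b] is its involution. *)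
    pose h b x := if c x == b then f x else f' x.
    have wfh b : wf_piece (Factor (h b)).
      case: wfU => _ _ fK f'K cE.
      have cf x : c (f x) = ~~ c x by case: (cE x).
      have cf' x : c (f' x) = ~~ c x by rewrite -[x in RHS]f'K cf negbK.
      split=> x; rewrite /h.
        have [cx|cx] := eqVneq (c x) b; rewrite ?cf ?cf' ?fK ?f'K.
          by rewrite -cx; case: (c x).
        by move: cx; case: (c x) b => -[].
      have [_|_] := eqVneq (c x) b; move/(congr1 c); rewrite ?cf ?cf'; by case: (c x).
    exists [:: Factor m, Factor (h true), Factor (h false) & Us'].
    split=> /=; [ | | lia..].
      apply: List.Forall_cons; first by case: wfU.
      by do 2!apply: List.Forall_cons => //.
    move=> x z /orP[|/cov' ->]; rewrite ?orbT //.
    rewrite !inE /h => /or3P[]/eqP->; case: (c x); by rewrite !eqxx ?orbT.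
  - have [Us' [wfUs' cov' Ef Ec Eq]] := IH y ley.
    exists (Quartic c f f' g g' :: Us'); split=> /=; [by constructor | | lia..].
    by move=> x z /orP[->|/cov' ->]; rewrite ?orbT.
by rewrite -Ef -Ec -Eq; apply: URD_of_pieces => // [x z /covUs/covUs'//|]; lia.
Qed.

(** * Templates and their lifts to K_v *)

(* The vertex u of K_v is read as the pair (u %/ 6, u %% 6).  A template is a
   piece on bool * {0, .., 5}: it sees only the side p (u %/ 6) of the first
   coordinate.  Its arc (t, y) at the vertex (a, x) leads to (mv t a, y), which
   is on the other side exactly when t || fl. *)
Definition template := piece (bool * nat).

Definition template_vertices : seq (bool * nat) :=
  [seq (p, x) | p <- [:: false; true], x <- iota 0 6].

Definition arc_end (fl : bool) (u q : bool * nat) : bool * nat :=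
  (u.1 (+) (q.1 || fl), q.2).

(** The reverse arc carries the same flag, because each [mv t] is an involution. *)
Definition arcs_inverse fl (f f' : bool * nat -> bool * nat) : bool :=
  all (fun u => ((f u).2 < 6) && (f' (arc_end fl u (f u)) == ((f u).1, u.2)))
    template_vertices.

Definition arcs_irreflexive fl (f : bool * nat -> bool * nat) : bool :=
  all (fun u => arc_end fl u (f u) != u) template_vertices.

Definition arcs_colour (T : eqType) fl (f : bool * nat -> bool * nat)
    (c : bool * nat -> T) (h : T -> T) : bool :=
  all (fun u => c (arc_end fl u (f u)) == h (c u)) template_vertices.

Definition wf_template fl (U : template) : bool :=
  match U with
  | Factor m => arcs_inverse fl m m && arcs_irreflexive fl m
  | Cubic c m f f' =>
    [&& arcs_inverse fl m m, arcs_irreflexive fl m, arcs_inverse fl f f',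
        arcs_inverse fl f' f, arcs_colour fl m c id & arcs_colour fl f c negb]
  | Quartic c f f' g g' =>
    [&& arcs_inverse fl f f', arcs_inverse fl f' f, arcs_inverse fl g g',
        arcs_inverse fl g' g, all (fun u => c u < 3) template_vertices,
        arcs_colour fl f c (fun i => (i + 1) %% 3)
      & arcs_colour fl g c (fun i => (i + 2) %% 3)]
  end.

(** The exempted pair is the vertex itself, reached with flag false; it occurs only when [fl] is
    false. *)
Definition templates_cover fl (Us : seq template) : bool :=
  all (fun u => all (fun q =>
      (arc_end fl u q == u) && ~~ q.1 || has (fun U => q \in neighbours U u) Us)
    template_vertices) template_vertices.

(** With [fl] true both flags follow factors that swap the sides; with [fl] false, flag false stays
    on its side. *)
Definition moves_along n fl (mv : bool -> nat -> nat) (p : nat -> bool) : Prop :=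
  forall t a, a <= n ->
    [/\ mv t a <= n, mv t (mv t a) = a & p (mv t a) = p a (+) (t || fl)].

Definition side p (u : nat) : bool * nat := (p (u %/ 6), u %% 6).

Definition lift_arcs v mv p (f : bool * nat -> bool * nat) (u : 'I_v.+1) :
    'I_v.+1 :=
  let q := f (side p u) in inord (6 * mv q.1 (u %/ 6) + q.2).

Definition lift_template v mv p (U : template) : piece 'I_v.+1 :=
  let F := @lift_arcs v mv p in
  match U with
  | Factor m => Factor (F m)
  | Cubic c m f f' => Cubic (fun u : 'I_v.+1 => c (side p u)) (F m) (F f) (F f')
  | Quartic c f f' g g' =>
    Quartic (fun u : 'I_v.+1 => c (side p u)) (F f) (F f') (F g) (F g')
  end.

Lemma side_in p u : side p u \in template_vertices.
Proof.
apply/allpairsP; exists (side p u); split=> //.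
  by rewrite /side !inE; case: (p _).
by rewrite mem_iota ltn_pmod.
Qed.

(** The bound in [arcs_inverse] keeps the new Z_6-coordinate below 6, so [inord] is in range and
    quotient and remainder by 6 recover the pair. *)
Lemma lift_arcsE n v fl mv p f f' (u : 'I_v.+1) :
  v.+1 = 6 * n.+1 -> moves_along n fl mv p -> arcs_inverse fl f f' ->
  lift_arcs mv p f u = 6 * mv (f (side p u)).1 (u %/ 6) + (f (side p u)).2 :> nat
  /\ side p (lift_arcs mv p f u) = arc_end fl (side p u) (f (side p u)).
Proof.
move=> Ev mvP /allP/(_ _ (side_in p u))/andP[lt6 _].
have leun : u %/ 6 <= n by have := ltn_ord u; lia.
have [len _ pE] := mvP (f (side p u)).1 (u %/ 6) leun.
have Eu : lift_arcs mv p f u = 6 * mv (f (side p u)).1 (u %/ 6) + (f (side p u)).2 :> nat.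
  by rewrite inordK //; lia.
split=> //; rewrite {1}/side Eu mulnC divnMDl // modnMDl (divn_small lt6) (modn_small lt6).
by rewrite addn0 pE.
Qed.

Lemma lift_arcsK n v fl mv p f f' :
  v.+1 = 6 * n.+1 -> moves_along n fl mv p ->
  arcs_inverse fl f f' -> arcs_inverse fl f' f ->
  cancel (@lift_arcs v mv p f) (lift_arcs mv p f').
Proof.
move=> Ev mvP fK f'K u; apply: val_inj => /=.
have [Eu Su] := lift_arcsE u Ev mvP fK.
have [-> _] := lift_arcsE (lift_arcs mv p f u) Ev mvP f'K.
have /allP/(_ _ (side_in p u))/andP[lt6 /eqP] := fK.
have -> : lift_arcs mv p f u %/ 6 = mv (f (side p u)).1 (u %/ 6).
  by rewrite Eu; lia.
rewrite Su => -> /=.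
have leun : u %/ 6 <= n by have := ltn_ord u; lia.
have [_ -> _] := mvP (f (side p u)).1 (u %/ 6) leun.
by rewrite mulnC -divn_eq.
Qed.

Lemma lift_arcs_colour n v fl mv p f f' (T : eqType) (c : _ -> T) h (u : 'I_v.+1) :
  v.+1 = 6 * n.+1 -> moves_along n fl mv p -> arcs_inverse fl f f' ->
  arcs_colour fl f c h ->
  c (side p (lift_arcs mv p f u)) = h (c (side p u)).
Proof.
move=> Ev mvP fK /allP/(_ _ (side_in p u))/eqP <-.
by have [_ ->] := lift_arcsE u Ev mvP fK.
Qed.

Lemma lift_arcs_irreflexive n v fl mv p f f' (u : 'I_v.+1) :
  v.+1 = 6 * n.+1 -> moves_along n fl mv p -> arcs_inverse fl f f' ->
  arcs_irreflexive fl f -> lift_arcs mv p f u <> u.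
Proof.
move=> Ev mvP fK /allP/(_ _ (side_in p u))/eqP ne Eu; apply: ne.
by have [_ <-] := lift_arcsE u Ev mvP fK; rewrite Eu.
Qed.

Lemma wf_lift n v fl mv p U :
  v.+1 = 6 * n.+1 -> moves_along n fl mv p -> wf_template fl U ->
  wf_piece (@lift_template v mv p U).
Proof.
move=> Ev mvP; case: U => [m|c m f f'|c f f' g g'];
  rewrite /wf_template /wf_piece /lift_template.
- case/andP=> mK nm; split; first exact: (lift_arcsK Ev mvP mK mK).
  by move=> u; apply: (lift_arcs_irreflexive Ev mvP mK nm).
- case/and5P=> mK nm fK f'K /andP[cm cf].
  split; [exact: (lift_arcsK Ev mvP mK mK) | | exact: (lift_arcsK Ev mvP fK f'K) |
          exact: (lift_arcsK Ev mvP f'K fK) | ].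
    by move=> u; apply: (lift_arcs_irreflexive Ev mvP mK nm).
  by move=> u; rewrite (lift_arcs_colour u Ev mvP mK cm) (lift_arcs_colour u Ev mvP fK cf).
- case/and5P=> fK f'K gK g'K /and3P[c3 cf cg].
  split; [exact: (lift_arcsK Ev mvP fK f'K) | exact: (lift_arcsK Ev mvP f'K fK) |
          exact: (lift_arcsK Ev mvP gK g'K) | exact: (lift_arcsK Ev mvP g'K gK) | ].
  move=> u; rewrite (lift_arcs_colour u Ev mvP fK cf) (lift_arcs_colour u Ev mvP gK cg).
  by split=> //; exact: (allP c3 _ (side_in p u)).
Qed.

Lemma wf_lifts n v fl mv p Us :
  v.+1 = 6 * n.+1 -> moves_along n fl mv p -> all (wf_template fl) Us ->
  List.Forall (@wf_piece _) [seq @lift_template v mv p U | U <- Us].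
Proof.
move=> Ev mvP; elim: Us => [|U Us IH] /=; first by constructor.
by case/andP=> wfU /IH; constructor=> //; apply: (wf_lift Ev mvP wfU).
Qed.

Lemma lifts_cover v fl mv p Us (u w : 'I_v.+1) t :
  templates_cover fl Us -> (arc_end fl (side p u) (t, w %% 6) == side p u) && ~~ t = false ->
  w %/ 6 = mv t (u %/ 6) ->
  has (fun U => w \in neighbours U u) [seq @lift_template v mv p U | U <- Us].
Proof.
move=> /allP/(_ _ (side_in p u))/allP cov ne Ew.
have : (t, w %% 6) \in template_vertices.
  apply/allpairsP; exists (t, w %% 6); split=> //; last by rewrite mem_iota ltn_pmod.
  by rewrite !inE; case: (t).
move/cov; rewrite ne /= has_map.
have Ef f : (t, w %% 6) = f (side p u) -> w = lift_arcs mv p f u.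
  by move=> Eq; apply: val_inj; rewrite /= /lift_arcs -Eq /= -Ew mulnC -divn_eq inordK.
apply: sub_has => -[m|c m f f'|c f f' g g'] /=; rewrite !inE.
- by move/eqP/Ef/eqP.
- by case/or3P=> /eqP/Ef/eqP->; rewrite ?orbT.
- by case/or4P=> /eqP/Ef/eqP->; rewrite ?orbT.
Qed.

(** * The explicit templates *)

(** A translation of Z_6, by d0 on side false and by minus d1 on side true; on arcs that swap sides,
    exchanging d0 and d1 inverts it. *)
Definition shift (d0 d1 : bool * nat) (u : bool * nat) : bool * nat :=
  if u.1 then (d1.1, (u.2 + 6 - d1.2) %% 6) else (d0.1, (u.2 + d0.2) %% 6).

Definition cubic_shift (c : bool * nat -> bool) d f0 f1 : template :=
  Cubic c (shift d d) (shift f0 f1) (shift f1 f0).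

Definition quartic_shift (c : bool * nat -> nat) f0 f1 g0 g1 : template :=
  Quartic c (shift f0 f1) (shift f1 f0) (shift g0 g1) (shift g1 g0).

(** Each flag gives a K_{6,6} per edge of its factor, cut by differences into {0, 1, 3} and {5, 2,
    4}. *)
Definition pair_cubics : seq template :=
  flatten [seq [:: cubic_shift (fun u => odd u.2) (t, 0) (t, 1) (t, 3);
                   cubic_shift (fun u => odd u.2 (+) u.1) (t, 5) (t, 2) (t, 4)]
          | t <- [:: false; true]].

(** Six differences per flag are not a multiple of four, so the third graph takes two differences
    from each of the two factors. *)
Definition pair_quartics : seq template :=
  [:: quartic_shift (fun u => (u.2 + 2 * u.1) %% 3)
        (false, 2) (false, 0) (false, 3) (false, 5);
      quartic_shift (fun u => (u.2 + u.1) %% 3)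
        (true, 0) (true, 1) (true, 4) (true, 3);
      quartic_shift (fun u => u.2 %% 3)
        (false, 1) (true, 2) (true, 5) (false, 4)].

(** Tables number the vertex (p, x) of K_12 as 6 p + x. *)
Definition table_arc (l : seq nat) (u : bool * nat) : bool * nat :=
  let q := nth 0 l (6 * u.1 + u.2) in ((5 < q) (+) u.1, q %% 6).

Definition cubic_table (c : seq bool) (m f : seq nat) : template :=
  Cubic (fun u : bool * nat => nth false c (6 * u.1 + u.2)) (table_arc m) (table_arc f)
    (table_arc [seq index i f | i <- iota 0 12]).

(* K12_templates 0 was found by computer search. *)
Definition K12_templates (b : nat) : seq template :=
  let K4s := cubic_shift fst (false, 3) (true, 0) (true, 3) in
  let inside := quartic_shift (fun u => u.2 %% 3)
    (false, 1) (false, 5) (false, 2) (false, 4) in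
  match b with
  | 0 =>
    [:: cubic_table [:: true; false; true; true; false; false; false; true; false; true; false; true]
         [:: 11; 4; 9; 7; 1; 10; 8; 3; 6; 2; 5; 0]
         [:: 4; 0; 5; 6; 7; 3; 9; 8; 11; 1; 2; 10];
       cubic_table [:: true; false; true; true; false; false; false; true; true; true; false; false]
         [:: 8; 11; 3; 2; 5; 4; 10; 9; 0; 7; 6; 1]
         [:: 10; 7; 6; 1; 2; 8; 0; 5; 4; 11; 9; 3];
       cubic_table [:: false; true; true; true; true; false; false; true; false; false; false; true]
         [:: 9; 2; 1; 4; 3; 6; 5; 11; 10; 0; 8; 7]
         [:: 2; 5; 8; 9; 10; 11; 7; 0; 3; 4; 1; 6];
       Factor (table_arc [:: 5; 6; 7; 10; 11; 0; 1; 2; 9; 8; 3; 4]);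
       Factor (table_arc [:: 3; 8; 11; 0; 6; 9; 4; 10; 1; 5; 7; 2])]
  | 1 =>
    [:: K4s; inside;
        cubic_shift (fun u => odd u.2) (true, 2) (true, 1) (true, 5);
        Factor (shift (true, 4) (true, 4))]
  | _ =>
    [:: K4s; inside;
        quartic_shift (fun u => u.2 %% 3) (true, 1) (true, 2) (true, 5) (true, 4)]
  end.

Lemma pair_templates_ok :
  [/\ all (wf_template true) pair_cubics, all (wf_template true) pair_quartics,
      templates_cover true pair_cubics & templates_cover true pair_quartics].
Proof. by split; vm_compute. Qed.

Lemma K12_templates_ok b :
  all (wf_template false) (K12_templates b) /\
  templates_cover false (K12_templates b).
Proof. by case: b => [|[|b]]; split; vm_compute. Qed.

(** * The 1-factorization GK *)

(* The 1-factorization GK of the complete graph on {0, .., n}, n odd, where n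
   plays the point at infinity: a and b are matched by the j-th factor when
   a + b = 2 j modulo n. *)
Definition gk (n j a : nat) : nat :=
  if a == n then j
  else if a == j then n
  else if a <= 2 * j then if 2 * j - a < n then 2 * j - a else 2 * j - a - n
  else 2 * j + n - a.

(* The factors j and j.+1 form a Hamiltonian cycle; this is its proper
   2-colouring. *)
Definition gk_side (n j a : nat) : bool :=
  let e := if j <= a then a - j else a + n - j in
  (a != n) && ((e == 0) || odd e).

Lemma gkP n j a : j < n -> a <= n ->
  (a = n /\ gk n j a = j) \/ (a = j /\ gk n j a = n) \/
  (a < n /\ a <> j /\ gk n j a < n /\
   (a + gk n j a = 2 * j \/ a + gk n j a = 2 * j + n \/
    a + gk n j a + n = 2 * j)).
Proof.
move=> ltj lea; rewrite /gk; case: (a =P n) => [->|an]; first by left.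
case: (a =P j) => [->|aj]; first by right; left.
by right; right; do !case: ifP => *; lia.
Qed.

Lemma gk_le n j a : j < n -> a <= n -> gk n j a <= n.
Proof. by move=> ltj lea; have := gkP ltj lea; lia. Qed.

Lemma gkK n j a : j < n -> a <= n -> gk n j (gk n j a) = a.
Proof.
move=> ltj lea; have := gkP ltj lea; have := gkP ltj (gk_le ltj lea); lia.
Qed.

(** With e = a - j modulo n, the factor j sends e to n - e, of other parity as n is odd, and matches
    e = 0 with infinity. *)
Lemma gk_side_gk n j a : odd n -> j < n -> a <= n ->
  gk_side n j (gk n j a) = ~~ gk_side n j a.
Proof.
move=> on ltj lea; have := gkP ltj lea; move: (gk n j a) => b.
by rewrite /gk_side; do !case: ifP => *; lia.
Qed.

(** Here e goes to 2 - e modulo n: e = 0 is matched with 2, e = 1 with infinity, and the rest change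
    parity. *)
Lemma gk_side_gkS n j a : odd n -> j.+1 < n -> a <= n ->
  gk_side n j (gk n j.+1 a) = ~~ gk_side n j a.
Proof.
move=> on ltj lea; have := gkP ltj lea; move: (gk n j.+1 a) => b.
by rewrite /gk_side; do !case: ifP => *; lia.
Qed.

Lemma gk_cover n a b : odd n -> a <= n -> b <= n -> a != b ->
  exists2 j, j < n & gk n j a = b.
Proof.
move=> on lea leb nab.
have [an|an] := eqVneq a n; first by exists b; [lia | rewrite /gk an eqxx].
have [bn|bn] := eqVneq b n.
  by exists a; [lia | rewrite /gk (negPf an) eqxx].
(* Halving a + b modulo the odd number n. *)
have [j ltj Ej] : exists2 j, j < n &
    a + b = 2 * j \/ a + b = 2 * j + n \/ a + b + n = 2 * j.
  case: (boolP (odd (a + b))) => o; last by exists (a + b)./2; lia.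
  by case: (ltnP (a + b) n) => ?; [exists (a + b + n)./2 | exists (a + b - n)./2]; lia.
by exists j => //; have := gkP ltj lea; lia.
Qed.

(** The h-th pair consists of the factors 2h - 1 and 2h, factor 0 being reserved for the copies of
    K_12. *)
Lemma pair_moves m h : 0 < h -> h <= m ->
  moves_along (m.*2.+1) true (fun t => gk m.*2.+1 ((h.*2).-1 + t))
    (gk_side m.*2.+1 (h.*2).-1).
Proof.
move=> h_gt0 leh t a lea.
have ltj : (h.*2).-1 + t < m.*2.+1 by case: t; lia.
have on : odd m.*2.+1 by rewrite /= odd_double.
split; [exact: gk_le | exact: gkK |].
rewrite orbT addbT; case: t ltj => ltj.
  by rewrite addn1 gk_side_gkS //; lia.
by rewrite addn0 gk_side_gk //; lia.
Qed.

Lemma K12_moves m :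
  moves_along (m.*2.+1) false (fun t a => if t then gk m.*2.+1 0 a else a)
    (gk_side m.*2.+1 0).
Proof.
move=> [] a lea; split=> //; rewrite ?addbF ?addbT //.
- exact: gk_le.
- exact: gkK.
- by apply: gk_side_gk => //; rewrite /= odd_double.
Qed.

(** * Assembling K_v from the lifted templates *)

Definition lift_pair v m (h : nat) (Us : seq template) :
    seq (piece 'I_v.+1) :=
  [seq @lift_template v (fun t => gk m.*2.+1 ((h.*2).-1 + t)) (gk_side m.*2.+1 (h.*2).-1) U
     | U <- Us].

Definition lift_K12 v m (Us : seq template) : seq (piece 'I_v.+1) :=
  [seq @lift_template v (fun t a => if t then gk m.*2.+1 0 a else a) (gk_side m.*2.+1 0) U
     | U <- Us].

(* a is the number of pairs of factors of GK cut into quartic pieces. *)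
Definition pieces v m a b : seq (piece 'I_v.+1) :=
  lift_K12 v m (K12_templates b)
    ++ flatten [seq lift_pair v m h pair_quartics | h <- iota 1 a]
    ++ flatten [seq lift_pair v m h pair_cubics | h <- iota a.+1 (m - a)].

Lemma wf_pieces v m a b : v.+1 = 12 * m.+1 -> a <= m ->
  List.Forall (@wf_piece _) (pieces v m a b).
Proof.
move=> Ev leam; have Ev6 : v.+1 = 6 * (m.*2.+1).+1 by lia.
have [wfC wfQ _ _] := pair_templates_ok.
have wf_pairs s Us : all (wf_template true) Us -> all (fun h => 0 < h <= m) s ->
    List.Forall (@wf_piece _) (flatten [seq lift_pair v m h Us | h <- s]).
  move=> wfUs; elim: s => //= h s IH /andP[/andP[h_gt0 leh] /IH ?].
  apply/List.Forall_app; split=> //.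
  exact: (wf_lifts Ev6 (pair_moves h_gt0 leh) wfUs).
apply/List.Forall_app; split.
  exact: (wf_lifts Ev6 (@K12_moves m) (K12_templates_ok b).1).
by apply/List.Forall_app; split; apply: wf_pairs => //; apply/allP=> h;
  rewrite mem_iota; lia.
Qed.

Lemma pieces_cover v m a b (u w : 'I_v.+1) :
  v.+1 = 12 * m.+1 -> a <= m -> u != w ->
  has (fun U => w \in neighbours U u) (pieces v m a b).
Proof.
move=> Ev leam; rewrite -val_eqE /= => neq_uw; rewrite /pieces !has_cat.
set n := m.*2.+1; have on : odd n by rewrite /= odd_double.
have leu : u %/ 6 <= n by have := ltn_ord u; lia.
have lew : w %/ 6 <= n by have := ltn_ord w; lia.
have [eq_uw|ne] := eqVneq (u %/ 6) (w %/ 6).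
  apply/orP; left; apply: (lifts_cover (K12_templates_ok b).2 (t := false)) => //.
  rewrite /arc_end /side xpair_eqE /= addbF eqxx andbT.
  by apply: contra_neqF neq_uw => /eqP E; rewrite (divn_eq u 6) (divn_eq w 6) eq_uw E.
have [j ltj Ej] := gk_cover on leu lew ne.
have [j0|j_gt0] := posnP j.
  apply/orP; left; apply: (lifts_cover (K12_templates_ok b).2 (t := true)).
    by rewrite andbF.
  by rewrite -Ej j0.
(* Factor j lies in pair h, the half of j rounded up; the flag t is true for its even member 2h. *)
pose h := uphalf j; pose t := ~~ odd j.
have Ejh : j = (h.*2).-1 + t.
  by rewrite /h /t uphalf_half; case: odd (odd_double_half j); lia.
have pair_cov Us : templates_cover true Us ->
    has (fun U => w \in neighbours U u) (lift_pair v m h Us).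
  move=> covUs; apply: (lifts_cover covUs (t := t)).
    rewrite /arc_end /side xpair_eqE /= orbT addbT.
    by case: (gk_side _ _ _).
  by rewrite -Ejh Ej.
have [_ _ covC covQ] := pair_templates_ok.
have has_level s Us : templates_cover true Us -> h \in s ->
    has (fun U => w \in neighbours U u) (flatten [seq lift_pair v m h Us | h <- s]).
  move=> covUs; elim: s => //= h' s IH; rewrite inE has_cat.
  by case/predU1P=> [<-|/IH->]; rewrite ?pair_cov ?orbT.
have [leha|ltah] := leqP h a; apply/orP; right; apply/orP.
  by left; apply: has_level => //; rewrite mem_iota; lia.
by right; apply: has_level => //; rewrite mem_iota; lia.
Qed.

Lemma count_pieces v m a b : a <= m -> b < 3 ->
  [/\ count (@is_factor _) (pieces v m a b) = 2 - b,
      count (@is_cubic _) (pieces v m a b) = (3 - b) + 4 * (m - a)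
    & count (@is_quartic _) (pieces v m a b) = b + 3 * a].
Proof.
move=> leam ltb3.
have cnt (P : pred (piece 'I_v.+1)) (P' : pred template) Us s :
    (forall mv p U, P (@lift_template v mv p U) = P' U) ->
    count P (flatten [seq lift_pair v m h Us | h <- s]) = count P' Us * size s.
  move=> PP'; elim: s => [|h s IH] /=; first by rewrite muln0.
  rewrite count_cat IH mulnS /lift_pair count_map; congr (_ + _).
  by apply: eq_count => U /=; rewrite PP'.
have lf mv p U : is_factor (@lift_template v mv p U) = is_factor U by case: U.
have lc mv p U : is_cubic (@lift_template v mv p U) = is_cubic U by case: U.
have lq mv p U : is_quartic (@lift_template v mv p U) = is_quartic U by case: U.
split; rewrite !count_cat;
  [rewrite !(cnt _ _ _ _ lf) | rewrite !(cnt _ _ _ _ lc)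
    | rewrite !(cnt _ _ _ _ lq)];
  by rewrite !size_iota /=; case: b ltb3 => [|[|[|b]]] //= _; lia.
Qed.

(** Writing i = 3 a + b gives i quartic pieces. The bound on y fits the number of cubic ones, since
    (11 - 4 b) / 3 rounds down to 3 - b. *)
Lemma URD_exists v m i y : v.+1 = 12 * m.+1 -> 4 * i + 3 * y <= v ->
  exists Bs PC, @is_URD v.+1 (v - 4 * i - 3 * y) (3 * i) (2 * y) Bs PC.
Proof.
move=> Ev leiy; pose a := i %/ 3; pose b := i %% 3.
have ltb3 : b < 3 by rewrite ltn_pmod.
have Ei : i = 3 * a + b by rewrite mulnC -divn_eq.
have leam : a <= m by lia.
have [Ef Ec Eq] := count_pieces v leam ltb3.
have := @URD_of_pieces_split v (pieces v m a b) y (wf_pieces b Ev leam).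
rewrite Ef Ec Eq => /(_ _ _ _)[].
- by move=> u w; apply: pieces_cover.
- lia.
- lia.
move=> Bs [PC H]; exists Bs, PC.
have -> : v - 4 * i - 3 * y = 2 - b + 3 * (3 - b + 4 * (m - a) - y) by lia.
by have -> : 3 * i = 3 * (b + 3 * a) by lia.
Qed.

Unset Implicit Arguments.

Theorem mainTheorem1 (v : nat) (hv0 : (0 < v)%N) (hv : (12 %| v)%N) :
  forall x : int * int * int, URD v x <-> D v x.
Proof.
case: v hv0 hv => // v _ /dvdnP[[|m] Ev] // [[r s] t]; split.
  move=> [r' [s' [t' [[-> -> ->] [Bs [PC /URD_weight E]]]]]].
  (* The weight equation modulo 3 and modulo 2 makes s' divisible by 3 and t' even. *)
  pose i := (s' %/ 3)%N; pose y := (t' %/ 2)%N.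
  have Es : s' = (3 * i)%N by lia.
  have Et : t' = (2 * y)%N by lia.
  exists i; split; first by lia.
  exists (Posz y); split; last by congr (_, _, _); lia.
  (* In each residue class of i, [ymax] is (v - 4 i) / 3 rounded down, for v.+1 vertices. *)
  have Ei := divn_eq i 3; have := ltn_pmod i (isT : 0 < 3).
  rewrite /ymax; case: (i %% 3)%N Ei => [|[|[|j]]] // Ei _; lia.
move=> [i [lei [y [/andP[y0 ley]]]]] [-> -> ->].
have [y' Ey] : exists y', y = Posz y' by case: (y) y0 => // n _; exists n.
have leiy : (4 * i + 3 * y' <= v)%N.
  have Ei := divn_eq i 3; have := ltn_pmod i (isT : 0 < 3).
  by move: ley; rewrite /ymax; case: (i %% 3)%N Ei => [|[|[|j]]] // Ei; lia.
have [|Bs [PC H]] := @URD_exists v m i y' _ leiy; first by lia.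
exists (v - 4 * i - 3 * y')%N, (3 * i)%N, (2 * y')%N; split; last by exists Bs, PC.
by congr (_, _, _); lia.
Qed.
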